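(* Let $k$ be an infinite perfect field, let $m\ge 0$ and $n\ge 2$ be integers, let $r,s\ge 2$ be coprime integers, and let $$\mathcal{X}_m=\{\underline{x}^n z=y^r+t^s+x_0\}\subset\mathbb{A}^{m+4}_k=\mathrm{Spec}\,k[x_0,\dots,x_m,y,z,t],\qquad \underline{x}=\prod_{i=0}^m x_i .$$ Let $p\in\mathcal{X}_m(k)$ be the rational point with $x_0=\dots=x_m=1$, $y=0$, $z=1$, $t=0$. Then the strictly quasi-affine variety $\mathcal{X}_m\setminus\{p\}$ is $\mathbb{A}^1$-chain connected.
   Context: A smooth $k$-scheme $X$ is $\mathbb{A}^1$-chain connected if for every finitely generated separable field extension $L/k$ the set $X(L)$ is non-empty and for all $x,y\in X(L)$ there exist an integer $N$, points $x=x_0,x_1,\dots,x_N=y$ in $X(L)$ and morphisms $f_1,\dots,f_N\colon\mathbb{A}^1_L\to X$ (over $k$) with $f_i(0)=x_{i-1}$ and $f_i(1)=x_i$ for $1\le i\le N$. ''Strictly quasi-affine'' means quasi-affine but not affine. *)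

(* Defs.v *)
From HB Require Import structures.
From mathcomp Require Import all_boot all_order all_algebra.
From mathcomp Require Import separable.
From mathcomp Require Import mpoly.

Set Implicit Arguments.
Unset Strict Implicit.
Unset Printing Implicit Defensive.

Import GRing.Theory.
Local Open Scope ring_scope.

Definition infinite_field (k : fieldType) : Prop :=
  forall s : seq k, exists a : k, a \notin s.

Definition perfect_field (k : fieldType) : Prop :=
  forall p : {poly k}, irreducible_poly p -> separable_poly p.

Section FieldExtensions.
Variables (k L : fieldType) (iota : {rmorphism k -> L}).

(* a belongs to the subfield k(b_0, ..., b_(n-1)) of L *)
Definition in_subfield_gen (n : nat) (b : 'I_n -> L) (a : L) : Prop :=
  exists P Q : {mpoly k[n]},
    mmap iota b Q != 0 /\ a = mmap iota b P / mmap iota b Q.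

Definition finitely_generated_ext : Prop :=
  exists (n : nat) (b : 'I_n -> L), forall a : L, in_subfield_gen b a.

Definition algebraically_independent (n : nat) (b : 'I_n -> L) : Prop :=
  forall P : {mpoly k[n]}, mmap iota b P = 0 -> P = 0.

(* b is a transcendence basis of L/k over which L is separable algebraic.     *)
Definition separating_basis (n : nat) (b : 'I_n -> L) : Prop :=
  algebraically_independent b /\
  forall a : L, exists q : {poly L},
    [/\ forall i : nat, in_subfield_gen b q`_i, separable_poly q & root q a].

(* For finitely generated extensions (possibly transcendental), separable     *)
(* means separably generated.                                                 *)
Definition fg_separable_ext : Prop :=
  finitely_generated_ext /\
  exists (n : nat) (b : 'I_n -> L), separating_basis b.

End FieldExtensions.

(* A quasi-affine k-scheme of finite type, presented as the open complement   *)
(* of V(qa_neqs) in the closed subscheme V(qa_eqs) of affine qa_dim-space.    *)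
Record qaScheme (k : fieldType) := QaScheme {
  qa_dim : nat;
  qa_eqs : seq {mpoly k[qa_dim]};
  qa_neqs : seq {mpoly k[qa_dim]}
}.

(* The functor of points.  A nonzero commutative k-algebra is a ring A with   *)
(* its structure morphism iota; is_point iota x says that the coordinate      *)
(* vector x is a k-morphism Spec A -> X: it satisfies the equations, and its  *)
(* image avoids V(qa_neqs), i.e. the values of the qa_neqs generate the unit  *)
(* ideal of A.                                                                *)
Definition is_point (k : fieldType) (X : qaScheme k) (A : comNzRingType)
    (iota : {rmorphism k -> A}) (x : 'I_(qa_dim X) -> A) : Prop :=
  (forall f, f \in qa_eqs X -> mmap iota x f = 0) /\
  (exists c : nat -> A,
     \sum_(i < size (qa_neqs X)) c i * mmap iota x (qa_neqs X)`_i = 1).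

Definition is_kalg_hom (k : fieldType) (A B : comNzRingType)
    (iotaA : {rmorphism k -> A}) (iotaB : {rmorphism k -> B})
    (phi : {rmorphism A -> B}) : Prop :=
  forall a : k, phi (iotaA a) = iotaB a.

(* X is affine: its functor of points is representable (Yoneda), by the       *)
(* algebra B with universal point u.  The second alternative is the empty     *)
(* scheme, whose coordinate ring is zero and hence is not a comNzRingType.    *)
Definition affine (k : fieldType) (X : qaScheme k) : Prop :=
  (exists (B : comNzRingType) (iotaB : {rmorphism k -> B})
          (u : 'I_(qa_dim X) -> B),
     is_point iotaB u /\
     forall (A : comNzRingType) (iotaA : {rmorphism k -> A})
            (x : 'I_(qa_dim X) -> A),
       is_point iotaA x ->
       (exists phi : {rmorphism B -> A},
          is_kalg_hom iotaB iotaA phi /\ phi \o u =1 x) /\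
       (forall phi psi : {rmorphism B -> A},
          is_kalg_hom iotaB iotaA phi -> phi \o u =1 x ->
          is_kalg_hom iotaB iotaA psi -> psi \o u =1 x -> phi =1 psi))
  \/ (forall (A : comNzRingType) (iotaA : {rmorphism k -> A})
             (x : 'I_(qa_dim X) -> A), ~ is_point iotaA x).

(* Quasi-affineness is built into the type qaScheme. *)
Definition strictly_quasi_affine (k : fieldType) (X : qaScheme k) : Prop :=
  ~ affine X.

(* Smoothness over k of the finitely presented scheme X, by the infinitesimal *)
(* lifting property along square-zero extensions A -> B.                      *)
Definition smooth (k : fieldType) (X : qaScheme k) : Prop :=
  forall (A B : comNzRingType)
         (iotaA : {rmorphism k -> A}) (iotaB : {rmorphism k -> B})
         (phi : {rmorphism A -> B}),
    is_kalg_hom iotaA iotaB phi ->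
    (forall b : B, exists a : A, phi a = b) ->
    (forall a a' : A, phi a = 0 -> phi a' = 0 -> a * a' = 0) ->
    forall x : 'I_(qa_dim X) -> B, is_point iotaB x ->
      exists x' : 'I_(qa_dim X) -> A, is_point iotaA x' /\ phi \o x' =1 x.

(* The structure morphism k -> L[T] of the affine line over L. *)
Definition line_struct (k L : fieldType) (iota : {rmorphism k -> L}) :
  {rmorphism k -> {poly L}} := (polyC \o iota : {rmorphism k -> {poly L}}).

(* A k-morphism A^1_L -> X is an L[T]-point f of X, and its value at an L- *)
(* point a of the line is obtained by evaluating the coordinates of f at a.   *)
Definition chain_linked (k : fieldType) (X : qaScheme k) (L : fieldType)
    (iota : {rmorphism k -> L}) (x y : 'I_(qa_dim X) -> L) : Prop :=
  exists (N : nat) (w : nat -> 'I_(qa_dim X) -> L)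
         (f : nat -> 'I_(qa_dim X) -> {poly L}),
    [/\ w 0%N =1 x, w N =1 y,
        forall i, (i <= N)%N -> is_point iota (w i) &
        forall i, (1 <= i <= N)%N ->
          [/\ is_point (line_struct iota) (f i),
              forall j, (f i j).[0] = w i.-1 j &
              forall j, (f i j).[1] = w i j]].

Definition A1_chain_connected (k : fieldType) (X : qaScheme k) : Prop :=
  smooth X /\
  forall (L : fieldType) (iota : {rmorphism k -> L}),
    fg_separable_ext iota ->
    (exists x : 'I_(qa_dim X) -> L, is_point iota x) /\
    (forall x y : 'I_(qa_dim X) -> L,
       is_point iota x -> is_point iota y -> chain_linked iota x y).

(* The open complement of the rational point p in X: the two open conditions  *)
(* g <> 0 for some g in qa_neqs X, and x_j <> p_j for some j, are intersected *)
(* by multiplying the ideals.                                                 *)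
Definition remove_point (k : fieldType) (X : qaScheme k)
    (p : 'I_(qa_dim X) -> k) : qaScheme k :=
  QaScheme (qa_eqs X)
    [seq g * ('X_j - (p j)%:MP) | g <- qa_neqs X, j <- enum 'I_(qa_dim X)].

Section TheHypersurface.
Variables (k : fieldType) (m n r s : nat).

(* Affine (m+4)-space has coordinates x_0, ..., x_m, y, z, t, in this order.  *)
Definition idx_x (i : 'I_m.+1) : 'I_m.+4 := inord i.
Definition idx_y : 'I_m.+4 := inord m.+1.
Definition idx_z : 'I_m.+4 := inord m.+2.
Definition idx_t : 'I_m.+4 := inord m.+3.

Definition hyp_eq : {mpoly k[m.+4]} :=
  (\prod_(i < m.+1) 'X_(idx_x i)) ^+ n * 'X_idx_z
  - ('X_idx_y ^+ r + 'X_idx_t ^+ s + 'X_(idx_x ord0)).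

(* Closed in affine space: the open condition is the trivial one, D(1). *)
Definition hypersurface : qaScheme k := QaScheme [:: hyp_eq] [:: 1].

(* (1, ..., 1, 0, 1, 0) *)
Definition base_pt (j : 'I_m.+4) : k := ((j <= m)%N || (j == idx_z))%:R.

End TheHypersurface.

Arguments hypersurface k m n r s : clear implicits.
Arguments base_pt k m j : clear implicits.

Lemma is_point_base_pt (k : fieldType) (m n r s : nat) :
  (0 < r)%N -> (0 < s)%N ->
  is_point (X := hypersurface k m n r s) (idfun : {rmorphism k -> k}) (base_pt k m).
Proof.
move=> r_gt0 s_gt0; split=> [f|]; last first.
  by exists (fun=> 1); rewrite big_ord1 /= rmorph1 mulr1.
rewrite inE => /eqP->.
have Ex i : base_pt k m (idx_x i) = 1 :> k.
  have le_im := ltn_ord i; rewrite ltnS in le_im.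
  by rewrite /base_pt inordK ?le_im // ltnS (leq_trans le_im) // !leqW.
have Ey : base_pt k m (idx_y m) = 0 :> k.
  rewrite /base_pt -val_eqE /= !inordK ?ltnS ?leqW //.
  by rewrite -ltnS ltnn ltn_eqF.
have Ez : base_pt k m (idx_z m) = 1 :> k by rewrite /base_pt eqxx orbT.
have Et : base_pt k m (idx_t m) = 0 :> k.
  rewrite /base_pt -val_eqE /= !inordK ?ltnS ?leqW //.
  by rewrite leqNgt !ltnS !leqW // gtn_eqF.
rewrite /hyp_eq rmorphB rmorphM !rmorphD !rmorphXn rmorph_prod /=.
rewrite !mmapX !mmap1U Ey Ez Et Ex big1 => [|i _]; last by rewrite mmapX mmap1U.
by rewrite expr1n !expr0n !gtn_eqF // !add0r mulr1 subrr.
Qed.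

(* Main.v *)
Require Import Defs.
From HB Require Import structures.
From mathcomp Require Import all_boot all_order all_algebra.
From mathcomp Require Import fraction boolp ring zify.
From mathcomp Require Import mpoly.

(** Write [x] for the product of the [x_i] and [p] for the removed point.

    Chain connectedness.  The locus [z = 0] of the hypersurface does not
    contain [p], and it is the graph [x_0 = - (y ^+ r + t ^+ s)], an affine
    space; so any two of its points lie on a line ([linked_z0]), and it
    suffices to reach it from every point.  Where [x = 0], the equation does
    not involve [z], which can be moved to [0] ([linked_x0]).  Where [x] is
    nonzero, the [x_i] being fixed, [z] is a function of [y] and [t], and the
    fibre is a plane with at most one point missing, hence connected by
    broken lines ([linked_fibre11]).  To leave this fibre one needs a curve
    along which [x_0] varies and [z] stays a polynomial: with [x_0 = T], this
    asks for polynomials [y] and [t] with [y ^+ r + t ^+ s + T] divisible by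
    [T ^+ n].  As [r] and [s] are coprime, they are not both even, so that
    [y ^+ r + t ^+ s = 0] has a solution with coordinates [1] and [-1], and
    they are not both zero in the field, so that Hensel lifting deforms this
    solution while one of the two coordinates stays constant
    ([transversal_curve]).  At [T = 0] this curve arrives at [x = 0]
    ([linked_torus_z0]).

    Smoothness.  The partial derivatives along [x_0] and [z] generate the unit
    ideal for [n >= 2], by an explicit identity over any base ring; so a point
    lifts along a square-zero extension by one Newton step
    ([hyp_val_newton]).

    Failure of affineness.  The plane on which all [x_i] are [1], with
    coordinates [y] and [t], passes through [p], and a function on a plane
    without a point extends to the plane.  If the complement of [p] were
    affine, the inclusion of the punctured plane would therefore extend to
    the plane, and its value at the origin would be [p]
    ([punctured_not_affine]). *)

Set Implicit Arguments.
Unset Strict Implicit.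
Unset Printing Implicit Defensive.

Import GRing.Theory.
Local Open Scope ring_scope.

(** * Functoriality of points *)

Lemma mmap_morph (k : fieldType) (A B : comNzRingType) (d : nat)
    (iotaA : {rmorphism k -> A}) (iotaB : {rmorphism k -> B})
    (phi : {rmorphism A -> B}) (x : 'I_d -> A) (y : 'I_d -> B)
    (f : {mpoly k[d]}) :
  is_kalg_hom iotaA iotaB phi -> phi \o x =1 y ->
  mmap iotaB y f = phi (mmap iotaA x f).
Proof.
move=> phi_k xy; rewrite /mmap rmorph_sum; apply: eq_bigr => u _.
rewrite rmorphM phi_k /mmap1 rmorph_prod; congr (_ * _).
by apply: eq_bigr => i _; rewrite rmorphXn -xy.
Qed.

Lemma is_point_morph (k : fieldType) (X : qaScheme k) (A B : comNzRingType)
    (iotaA : {rmorphism k -> A}) (iotaB : {rmorphism k -> B})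
    (phi : {rmorphism A -> B}) (x : 'I_(qa_dim X) -> A) (y : 'I_(qa_dim X) -> B) :
  is_kalg_hom iotaA iotaB phi -> phi \o x =1 y ->
  is_point iotaA x -> is_point iotaB y.
Proof.
move=> phi_k xy [eqs [c cP]]; split=> [f f_eq|].
  by rewrite (mmap_morph _ phi_k xy) eqs // rmorph0.
exists (phi \o c); rewrite -(rmorph1 phi) -cP rmorph_sum.
by apply: eq_bigr => i _; rewrite rmorphM (mmap_morph _ phi_k xy).
Qed.

(** * Points of the punctured hypersurface *)

Notation punctured k m n r s :=
  (remove_point (X := hypersurface k m n r s) (base_pt k m)).

Definition x_prod (A : comNzRingType) (m : nat) (x : 'I_m.+4 -> A) : A :=
  \prod_(i < m.+1) x (idx_x i).

Definition hyp_val (A : comNzRingType) (m n r s : nat) (x : 'I_m.+4 -> A) : A :=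
  x_prod x ^+ n * x (idx_z m)
  - (x (idx_y m) ^+ r + x (idx_t m) ^+ s + x (idx_x ord0)).

Lemma mmap_hyp_eq (k : fieldType) (m n r s : nat) (A : comNzRingType)
    (iota : {rmorphism k -> A}) (x : 'I_m.+4 -> A) :
  mmap iota x (hyp_eq k m n r s) = hyp_val n r s x.
Proof.
rewrite /hyp_eq /hyp_val /x_prod.
rewrite rmorphB rmorphM !rmorphD !rmorphXn rmorph_prod /= !mmapX !mmap1U.
by under eq_bigr => i _ do rewrite mmapX mmap1U.
Qed.

Lemma is_point_puncturedP (k : fieldType) (m n r s : nat) (A : comNzRingType)
    (iota : {rmorphism k -> A}) (x : 'I_m.+4 -> A) :
  is_point (X := punctured k m n r s) iota x <->
  hyp_val n r s x = 0 /\
  exists c : 'I_m.+4 -> A, \sum_j c j * (x j - iota (base_pt k m j)) = 1.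
Proof.
pose s0 := qa_neqs (punctured k m n r s).
have szs : size s0 = m.+4 by rewrite /s0 /= size_cat size_map size_enum_ord addn0.
have nths (j : 'I_m.+4) : mmap iota x s0`_j = x j - iota (base_pt k m j).
  rewrite /s0 /= cats0 (nth_map ord0) ?size_enum_ord // nth_ord_enum mul1r.
  by rewrite rmorphB /= mmapX mmap1U mmapC.
have sums (c : nat -> A) :
    \sum_(i < size s0) c i * mmap iota x s0`_i =
    \sum_(j < m.+4) c j * (x j - iota (base_pt k m j)).
  by rewrite szs; apply: eq_bigr => j _; rewrite nths.
split=> [[eqs [c cP]] | [x_eqn [c cP]]].
  split; first by rewrite -(mmap_hyp_eq _ _ _ iota) eqs // inE.
  exists (fun j => c j); rewrite -[RHS]cP; symmetry; exact: (sums c).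
split=> [f|]; first by rewrite inE => /eqP ->; rewrite mmap_hyp_eq.
exists (fun i => c (inord i)); rewrite -[RHS]cP.
apply: etrans; first exact: (sums (fun i => c (inord i))).
by apply: eq_bigr => j _; rewrite inord_val.
Qed.

(** The lines and the test points used below have one coordinate that alone
    keeps them away from the base point. *)
Lemma is_point_unit (k : fieldType) (m n r s : nat) (A : comNzRingType)
    (iota : {rmorphism k -> A}) (x : 'I_m.+4 -> A) (j : 'I_m.+4) (c : A) :
  hyp_val n r s x = 0 -> c * (x j - iota (base_pt k m j)) = 1 ->
  is_point (X := punctured k m n r s) iota x.
Proof.
move=> x_eqn cP; apply/is_point_puncturedP; split=> //.
exists (fun i => if i == j then c else 0).
rewrite (bigD1 j) //= eqxx cP big1 ?addr0 // => i /negPf ->.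
by rewrite mul0r.
Qed.

Lemma hyp_val_morph (A B : comNzRingType) (phi : {rmorphism A -> B})
    (m n r s : nat) (x : 'I_m.+4 -> A) (y : 'I_m.+4 -> B) :
  phi \o x =1 y -> hyp_val n r s y = phi (hyp_val n r s x).
Proof.
move=> xy; rewrite /hyp_val /x_prod rmorphB rmorphM !rmorphD !rmorphXn rmorph_prod.
rewrite -!xy /=; congr (_ ^+ _ * _ - _).
by apply: eq_bigr => i _; rewrite -xy.
Qed.

Definition coords (A : Type) (m : nat) (v : 'I_m.+1 -> A) (y z t : A)
    (j : 'I_m.+4) : A :=
  if j == idx_y m then y else if j == idx_z m then z
  else if j == idx_t m then t else v (inord j).

Lemma idx_val (m : nat) (i : 'I_m.+1) :
  [/\ idx_x i = i :> nat, idx_y m = m.+1 :> nat, idx_z m = m.+2 :> nat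
    & idx_t m = m.+3 :> nat].
Proof. by split; rewrite inordK //; have := ltn_ord i; lia. Qed.

Lemma idx_xK (m : nat) (i : 'I_m.+1) : inord (idx_x i) = i.
Proof. by have [-> _ _ _] := idx_val i; rewrite inord_val. Qed.

Lemma coords_x (A : Type) (m : nat) (v : 'I_m.+1 -> A) (y z t : A) (i : 'I_m.+1) :
  coords v y z t (idx_x i) = v i.
Proof.
rewrite /coords idx_xK -!val_eqE; case: (idx_val i) => /= -> -> -> ->.
by rewrite !ltn_eqF //; have := ltn_ord i; lia.
Qed.

Lemma coords_y (A : Type) (m : nat) (v : 'I_m.+1 -> A) (y z t : A) :
  coords v y z t (idx_y m) = y.
Proof. by rewrite /coords eqxx. Qed.

Lemma coords_z (A : Type) (m : nat) (v : 'I_m.+1 -> A) (y z t : A) :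
  coords v y z t (idx_z m) = z.
Proof.
rewrite /coords eqxx -val_eqE; case: (idx_val (@ord0 m)) => /= _ -> -> _.
by rewrite gtn_eqF.
Qed.

Lemma coords_t (A : Type) (m : nat) (v : 'I_m.+1 -> A) (y z t : A) :
  coords v y z t (idx_t m) = t.
Proof.
rewrite /coords eqxx -!val_eqE; case: (idx_val (@ord0 m)) => /= _ -> -> ->.
by rewrite !gtn_eqF.
Qed.

Lemma coords_eta (A : Type) (m : nat) (x : 'I_m.+4 -> A) :
  coords (x \o @idx_x m) (x (idx_y m)) (x (idx_z m)) (x (idx_t m)) =1 x.
Proof.
move=> j; rewrite /coords; case: eqP => [-> //|neq_y].
case: eqP => [-> //|neq_z]; case: eqP => [-> //|neq_t] /=; congr x.
have lt_jm : (j < m.+1)%N.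
  have [_ vy vz vt] := idx_val (@ord0 m).
  have /eqP := neq_y; have /eqP := neq_z; have /eqP := neq_t.
  by rewrite -!val_eqE /= vy vz vt; have := ltn_ord j; lia.
by apply: val_inj; have [/= -> _ _ _] := idx_val (inord j : 'I_m.+1); rewrite inordK.
Qed.

Lemma coords_comp (A B : Type) (f : A -> B) (m : nat) (v : 'I_m.+1 -> A) (y z t : A) :
  f \o coords v y z t =1 coords (f \o v) (f y) (f z) (f t).
Proof. by move=> j; rewrite /coords /=; do !case: ifP => _. Qed.

Lemma hyp_val_coords (A : comNzRingType) (m n r s : nat) (v : 'I_m.+1 -> A) (y z t : A) :
  hyp_val n r s (coords v y z t) = (\prod_i v i) ^+ n * z - (y ^+ r + t ^+ s + v ord0).
Proof.
rewrite /hyp_val /x_prod coords_x coords_y coords_z coords_t.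
by congr (_ ^+ _ * _ - _); apply: eq_bigr => i _; apply: coords_x.
Qed.

Lemma base_pt_coords (k : fieldType) (m : nat) :
  base_pt k m =1 coords (fun=> 1) 0 1 0.
Proof.
move=> j; have [_ vy vz vt] := idx_val (@ord0 m).
rewrite /base_pt /coords -!val_eqE /= vy vz vt.
case: (eqVneq (j : nat) m.+2) => [-> | ne_z].
  by rewrite orbT !gtn_eqF.
rewrite orbF; have := ltn_ord j.
case: eqP => [-> _ | ne_y lt_j]; first by rewrite ltnn.
case: eqP => [-> | ne_t]; first by rewrite leqNgt ltnS !leqW.
by have -> : (j <= m)%N by lia.
Qed.

(** * Smoothness *)

Lemma exprD_taylor (A : comNzRingType) (x d : A) (n : nat) :
  exists e, (x + d) ^+ n.+1 = x ^+ n.+1 + n.+1%:R * x ^+ n * d + d * d * e.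
Proof.
elim: n => [|n [e eP]]; first by exists 0; rewrite !expr1 expr0; ring.
exists (n.+1%:R * x ^+ n + (x + d) * e).
by rewrite exprSr eP -(natr1 n.+1) !exprS; ring.
Qed.

Lemma sqr0_exprD (A : comNzRingType) (x d : A) (n : nat) :
  d * d = 0 -> (x + d) ^+ n.+1 = x ^+ n.+1 + n.+1%:R * x ^+ n * d.
Proof. by move=> dd; have [e ->] := exprD_taylor x d n; rewrite dd mul0r addr0. Qed.

(** Newton's step, with [n.+2] as exponent.  The partial derivatives of the
    equation are [w - 1] along [x_0], with [w] as in the proof, and
    [x_prod x ^+ n.+2] along [z].  The square [w ^+ 2] is a multiple of the
    latter since [2 * n.+1 >= n.+2], so that the identity
    [- (w + 1) * (w - 1) + w ^+ 2 = 1] is a unimodularity relation between the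
    two, valid over any ring; the second-order terms vanish with [e ^+ 2]. *)
Lemma hyp_val_newton (A : comNzRingType) (m n r s : nat) (x : 'I_m.+4 -> A)
    (e := hyp_val n.+2 r s x) :
  e * e = 0 ->
  exists d0 dz : A,
    hyp_val n.+2 r s
      (coords (fun i => x (idx_x i) + (e * d0) *+ (i == ord0)) (x (idx_y m))
         (x (idx_z m) + e * dz) (x (idx_t m))) = 0.
Proof.
move=> ee; pose x0 := x (idx_x ord0); pose z := x (idx_z m).
pose P := (\prod_(i < m) x (idx_x (lift ord0 i))) ^+ n.+2.
pose w := x0 ^+ n.+1 * P * z *+ n.+2.
pose q := x0 ^+ n * P * z * z *+ n.+2 *+ n.+2.
exists (w + 1), (- q); rewrite hyp_val_coords.
have eE : e = x0 ^+ n.+2 * P * z - (x (idx_y m) ^+ r + x (idx_t m) ^+ s + x0).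
  by rewrite /e /hyp_val /x_prod big_ord_recl exprMn.
have -> : (\prod_i (x (idx_x i) + (e * (w + 1)) *+ (i == ord0))) ^+ n.+2 =
          (x0 ^+ n.+2 + n.+2%:R * x0 ^+ n.+1 * (e * (w + 1))) * P.
  rewrite big_ord_recl eqxx exprMn sqr0_exprD; last by rewrite mulrACA ee mul0r.
  congr (_ * (_ ^+ _)); apply: eq_bigr => i _.
  by rewrite eq_sym (negPf (neq_lift _ _)) mulr0n addr0.
rewrite eqxx mulr1n -/x0 -/z.
have -> : x (idx_y m) ^+ r + x (idx_t m) ^+ s = x0 ^+ n.+2 * P * z - x0 - e.
  by rewrite eE; ring.
have ww : w * w = x0 ^+ n.+2 * P * q.
  by rewrite /w /q !exprS; ring.
have wE : x0 ^+ n.+1 * P * z * n.+2%:R = w by rewrite mulr_natr.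
set N := n.+2%:R in wE *.
set a := x0 ^+ n.+1 in wE *; set b := x0 ^+ n.+2 in eE ww *.
transitivity (e * ((w + 1) * (a * P * z * N - 1) + 1 - b * P * q)
              - e * e * (N * a * (w + 1) * P * q)); first by ring.
by rewrite wE ee mul0r subr0 -ww; ring.
Qed.

Lemma punctured_smooth (k : fieldType) (m n r s : nat) :
  (2 <= n)%N -> smooth (punctured k m n r s).
Proof.
case: n => [|[|n]] // _ A B iotaA iotaB phi phi_k phi_surj ker0.
change (forall x : 'I_m.+4 -> B,
  is_point (X := punctured k m n.+2 r s) iotaB x ->
  exists x' : 'I_m.+4 -> A,
    is_point (X := punctured k m n.+2 r s) iotaA x' /\ phi \o x' =1 x) => x.
move=> /is_point_puncturedP[x_eqn [c cP]].
have [a aP] : exists a : 'I_m.+4 -> A, forall j, phi (a j) = x j.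
  exact: fin_all_exists (fun j => phi_surj (x j)).
have [c' c'P] : exists c' : 'I_m.+4 -> A, forall j, phi (c' j) = c j.
  exact: fin_all_exists (fun j => phi_surj (c j)).
have e0 : phi (hyp_val n.+2 r s a) = 0.
  by rewrite -(hyp_val_morph _ _ _ (aP : phi \o a =1 x)).
have [d0 [dz x'_eqn]] := hyp_val_newton (ker0 _ _ e0 e0).
set x' := coords _ _ _ _ in x'_eqn; exists x'.
have x'P : phi \o x' =1 x.
  move=> j; rewrite -[RHS]coords_eta /x' coords_comp /coords.
  rewrite rmorphD rmorphM e0 mul0r addr0 !aP /=.
  by do !case: ifP => // _; rewrite rmorphD rmorphMn rmorphM e0 mul0r mul0rn addr0.
split=> //; apply/is_point_puncturedP; split=> //.
(* The lifted combination is 1 up to a square-zero error [h], and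
   [(1 + h) * (1 - h) = 1]. *)
pose h := \sum_j c' j * (x' j - iotaA (base_pt k m j)) - 1.
have h0 : phi h = 0.
  apply/eqP; rewrite rmorphB rmorph1 subr_eq0 -cP rmorph_sum; apply/eqP.
  by apply: eq_bigr => j _; rewrite rmorphM rmorphB phi_k c'P -x'P.
exists (fun j => (1 - h) * c' j).
under eq_bigr => j _ do rewrite -mulrA.
rewrite -mulr_sumr.
have -> : \sum_j c' j * (x' j - iotaA (base_pt k m j)) = 1 + h by rewrite /h; ring.
transitivity (1 - h * h); first by ring.
by rewrite ker0 // subr0.
Qed.

(** * Approximate roots and the transversal curve *)

(** Hensel lifting along the powers of ['X]: as [f] has constant coefficient 1,
    adding [c *: 'X^(N.+1)] to [f] changes [f ^+ s] by [s * c] at this order. *)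
Lemma approx_root (L : fieldType) (s N : nat) (g : {poly L}) :
  (s%:R : L) != 0 -> g.[0] = 1 ->
  exists f q : {poly L}, f.[0] = 1 /\ f ^+ s = g + 'X^(N.+1) * q.
Proof.
move=> s_neq0 g0; elim: N => [|N [f [q [f0 fP]]]].
  have /factor_theorem[q qP] : root (1 - g) 0.
    by rewrite rootE hornerD hornerN hornerC g0 subrr.
  exists 1, q; rewrite hornerC expr1n expr1; split=> //.
  by rewrite mulrC -['X]subr0 -polyC0 -qP; ring.
case: s s_neq0 fP => [|s] s_neq0 fP; first by rewrite eqxx in s_neq0.
pose c := - q.[0] / s.+1%:R; pose d := c%:P * 'X^(N.+1).
have [e eP] := exprD_taylor f d s.
have [u uP] : exists u, q + s.+1%:R * f ^+ s * c%:P = u * 'X.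
  have /factor_theorem[u uP] : root (q + s.+1%:R * f ^+ s * c%:P) 0.
    rewrite rootE hornerD !hornerM horner_exp hornerC f0 expr1n mulr1.
    by rewrite -polyC_natr hornerC /c mulrC divfK // subrr.
  by exists u; rewrite uP polyC0 subr0.
exists (f + d), (u + 'X^N * (c%:P * c%:P * e)); split.
  by rewrite hornerD f0 hornerM hornerXn expr0n mulr0 addr0.
rewrite eP fP /d.
transitivity (g + 'X^(N.+1) * (q + s.+1%:R * f ^+ s * c%:P)
              + 'X^(N.+1) * 'X^(N.+1) * (c%:P * c%:P * e)); first by ring.
by rewrite uP !exprS; ring.
Qed.

(** As [r] or [s] is odd, [(-1, 1)] or [(1, -1)] lies on the curve
    [y ^+ r + t ^+ s = 0].  With [y] kept constant, the equation
    [t ^+ s = - y ^+ r - 'X] is then an approximate [s]-th root problem, up to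
    the sign of [t]. *)
Lemma curve_through_cusp (L : fieldType) (r s N : nat) :
  coprime r s -> (s%:R : L) != 0 ->
  exists (c : L) (f q : {poly L}),
    c != 0 /\ c%:P ^+ r + f ^+ s + 'X = 'X^(N.+1) * q.
Proof.
move=> rs s_neq0; case r_odd: (odd r).
  have [|f [q [_ fP]]] := @approx_root L s N (1 - 'X) s_neq0.
    by rewrite !hornerE subr0.
  exists (-1), f, q; rewrite oppr_eq0 oner_eq0; split=> //.
  by rewrite polyCN polyC1 -signr_odd r_odd fP; ring.
have s_odd : odd s.
  have : ~~ (2 %| gcdn r s)%N by rewrite (eqP rs).
  by rewrite dvdn_gcd !dvdn2 r_odd negbK.
have [|f [q [_ fP]]] := @approx_root L s N (1 + 'X) s_neq0.
  by rewrite hornerD hornerX hornerC addr0.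
exists 1, (- f), (- q); rewrite oner_eq0 exprNn -signr_odd s_odd fP; split=> //.
by rewrite polyC1 expr1n; ring.
Qed.

Lemma coprime_natf_neq0 (L : fieldType) (r s : nat) :
  coprime r s -> (r%:R : L) != 0 \/ (s%:R : L) != 0.
Proof.
have [r0 | r_neq0] := eqVneq (r%:R : L) 0; last by left.
have [s0 | s_neq0] := eqVneq (s%:R : L) 0; last by right.
move=> rs; case: (posnP r) => [r_eq0 | r_gt0].
  by move: rs s0; rewrite r_eq0 /coprime gcd0n => /eqP -> /eqP; rewrite oner_eq0.
case: (egcdnP s r_gt0) => u v uv _; move: (congr1 (fun i => i%:R : L) uv).
rewrite (eqP rs) natrD !natrM r0 s0 !mulr0 add0r => /esym/eqP.
by rewrite oner_eq0.
Qed.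

(** Since [r] and [s] do not both vanish in [L], the exponent whose root has to
    be taken can be chosen invertible; it decides which coordinate is
    constant. *)
Lemma transversal_curve (L : fieldType) (r s N : nat) :
  coprime r s ->
  exists (c : L) (f g q : {poly L}),
    [/\ c != 0, f = c%:P \/ g = c%:P & f ^+ r + g ^+ s + 'X = 'X^(N.+1) * q].
Proof.
move=> rs; case: (coprime_natf_neq0 L rs) => [r_neq0 | s_neq0].
  have [|c [f [q [c_neq0 fP]]]] := @curve_through_cusp L s r N _ r_neq0.
    by rewrite coprime_sym.
  by exists c, f, c%:P, q; split; [| right | rewrite -fP [f ^+ r + _]addrC].
have [c [f [q [c_neq0 fP]]]] := @curve_through_cusp L r s N rs s_neq0.
by exists c, c%:P, f, q; split; [| left |].
Qed.

(** * Chains of affine lines *)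

Lemma chain_linked_trans (k : fieldType) (X : qaScheme k) (L : fieldType)
    (iota : {rmorphism k -> L}) (x y z : 'I_(qa_dim X) -> L) :
  chain_linked iota x y -> chain_linked iota y z -> chain_linked iota x z.
Proof.
move=> [N1 [w1 [f1 [w1_0 w1_N w1_pt f1P]]]] [N2 [w2 [f2 [w2_0 w2_N w2_pt f2P]]]].
exists (N1 + N2)%N, (fun i => if (i <= N1)%N then w1 i else w2 (i - N1)%N),
  (fun i => if (i <= N1)%N then f1 i else f2 (i - N1)%N).
have w2E j : w2 0 j = w1 N1 j by rewrite w2_0 w1_N.
split=> // [j | i le_i | i /andP[i_gt0 le_i]].
- case: leqP => [le_N | _]; last by rewrite addKn w2_N.
  have N2_0 : N2 = 0 by lia.
  by rewrite N2_0 addn0 -w2E -w2_N N2_0.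
- by case: leqP => ?; [apply: w1_pt | apply: w2_pt; lia].
case: leqP => lt_i.
  have [|f_pt f_0 f_1] := f1P i; first by rewrite i_gt0.
  by have -> : (i.-1 <= N1)%N by lia.
have [|f_pt f_0 f_1] := f2P (i - N1)%N; first by lia.
split=> // j; rewrite f_0; case: leqP => ?; last by congr (w2 _ _); lia.
have -> : i = N1.+1 by lia.
by rewrite subSnn /= w2E.
Qed.

(** Links in both directions; it frees the sequel from the orientation of
    chains. *)
Definition linked (k : fieldType) (X : qaScheme k) (L : fieldType)
    (iota : {rmorphism k -> L}) (x y : 'I_(qa_dim X) -> L) : Prop :=
  chain_linked iota x y /\ chain_linked iota y x.

Lemma linked_sym (k : fieldType) (X : qaScheme k) (L : fieldType)
    (iota : {rmorphism k -> L}) (x y : 'I_(qa_dim X) -> L) :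
  linked iota x y -> linked iota y x.
Proof. by case. Qed.

Lemma linked_trans (k : fieldType) (X : qaScheme k) (L : fieldType)
    (iota : {rmorphism k -> L}) (x y z : 'I_(qa_dim X) -> L) :
  linked iota x y -> linked iota y z -> linked iota x z.
Proof. by case=> xy yx [yz zy]; split; apply: chain_linked_trans; eassumption. Qed.

(** Reparametrizing by [T |-> a + (b - a) T] joins the points at any two
    parameters [a] and [b], in either order. *)
Lemma linked_line (k : fieldType) (X : qaScheme k) (L : fieldType)
    (iota : {rmorphism k -> L}) (f : 'I_(qa_dim X) -> {poly L}) (a b : L) :
  is_point (line_struct iota) f ->
  linked iota (fun j => (f j).[a]) (fun j => (f j).[b]).
Proof.
move=> f_pt.
have link c d : chain_linked iota (fun j => (f j).[c]) (fun j => (f j).[d]).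
  have f_eval e : is_point iota (fun j => (f j).[e]).
    apply: (@is_point_morph _ _ _ _ _ _ (horner_eval e) f) f_pt => // u.
    exact: hornerC.
  exists 1, (fun i j => (f j).[if i == 0 then c else d]),
    (fun _ j => f j \Po (c%:P + (d - c)%:P * 'X)).
  split=> // i.
  rewrite -eqn_leq => /eqP <-; split=> [| j | j].
  - pose phi : {rmorphism _ -> _} := comp_poly (c%:P + (d - c)%:P * 'X).
    by apply: (@is_point_morph _ _ _ _ _ _ phi f) f_pt => // u; apply: comp_polyC.
  - by rewrite horner_comp !hornerE.
  - by rewrite horner_comp hornerD hornerM !hornerC hornerX mulr1 addrC subrK.
by split; apply: link.
Qed.

(** * Lines in the punctured hypersurface *)

Lemma linked_coords (k : fieldType) (m n r s : nat) (L : fieldType)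
    (iota : {rmorphism k -> L}) (v : 'I_m.+1 -> {poly L}) (y z t : {poly L})
    (a b : L) (j : 'I_m.+4) (c : L) :
  (\prod_i v i) ^+ n * z = y ^+ r + t ^+ s + v ord0 ->
  coords v y z t j = c%:P -> c != iota (base_pt k m j) ->
  linked (X := punctured k m n r s) iota
    (coords (fun i => (v i).[a]) y.[a] z.[a] t.[a])
    (coords (fun i => (v i).[b]) y.[b] z.[b] t.[b]).
Proof.
move=> eq_f fj c_neq.
have evalE e : coords (fun i => (v i).[e]) y.[e] z.[e] t.[e] =
               fun j => (coords v y z t j).[e].
  by apply/funext => i; rewrite -(coords_comp (fun p => p.[e])).
rewrite !evalE; apply: (@linked_line _ (punctured k m n r s)).
apply: (@is_point_unit _ _ _ _ _ _ _ _ j (c - iota (base_pt k m j))^-1%:P).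
  by rewrite hyp_val_coords eq_f subrr.
by rewrite fj -polyCB -polyCM mulVf // subr_eq0.
Qed.

Definition segment (L : fieldType) (a b : L) : {poly L} := a%:P + (b - a)%:P * 'X.

Lemma segment0 (L : fieldType) (a b : L) : (segment a b).[0] = a.
Proof. by rewrite hornerD hornerM !hornerC hornerX mulr0 addr0. Qed.

Lemma segment1 (L : fieldType) (a b : L) : (segment a b).[1] = b.
Proof. by rewrite hornerD hornerM !hornerC hornerX mulr1 addrC subrK. Qed.

Lemma base_ptE (k : fieldType) (m : nat) (L : fieldType)
    (iota : {rmorphism k -> L}) (j : 'I_m.+4) :
  iota (base_pt k m j) = coords (fun=> 1) 0 1 0 j.
Proof.
rewrite base_pt_coords -[LHS]/((iota \o _) j) coords_comp /coords /=.
by rewrite rmorph0 rmorph1.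
Qed.

(** The locus [z = 0] avoids the base point and is the graph
    [x_0 = - (y ^+ r + t ^+ s)], an affine space: any two of its points lie
    on one line. *)
Lemma linked_z0 (k : fieldType) (m n r s : nat) (L : fieldType)
    (iota : {rmorphism k -> L}) (v v' : 'I_m.+1 -> L) (y t y' t' : L) :
  y ^+ r + t ^+ s + v ord0 = 0 -> y' ^+ r + t' ^+ s + v' ord0 = 0 ->
  linked (X := punctured k m n r s) iota (coords v y 0 t) (coords v' y' 0 t').
Proof.
move=> vE v'E; pose Y := segment y y'; pose T := segment t t'.
pose V i := if i == ord0 then - (Y ^+ r + T ^+ s) else segment (v i) (v' i).
have V0 : (fun i => (V i).[0]) = v.
  apply/funext => i; rewrite /V; case: eqP => [->|_]; rewrite ?segment0 //.
  rewrite hornerN hornerD !horner_exp !segment0.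
  by apply/eqP; rewrite eq_sym -addr_eq0 addrC vE.
have V1 : (fun i => (V i).[1]) = v'.
  apply/funext => i; rewrite /V; case: eqP => [->|_]; rewrite ?segment1 //.
  rewrite hornerN hornerD !horner_exp !segment1.
  by apply/eqP; rewrite eq_sym -addr_eq0 addrC v'E.
have := @linked_coords k m n r s L iota V Y 0 T 0 1 (idx_z m) 0.
rewrite V0 V1 !segment0 !segment1 !hornerC; apply.
- by rewrite mulr0 /V eqxx subrr.
- by rewrite coords_z polyC0.
by rewrite base_ptE coords_z eq_sym oner_eq0.
Qed.

(** On the locus [x_prod = 0] the equation does not involve [z]. *)
Lemma linked_x0 (k : fieldType) (m n r s : nat) (L : fieldType)
    (iota : {rmorphism k -> L}) (v : 'I_m.+1 -> L) (y t z z' : L) :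
  (0 < n)%N -> \prod_i v i = 0 -> y ^+ r + t ^+ s + v ord0 = 0 ->
  linked (X := punctured k m n r s) iota (coords v y z t) (coords v y z' t).
Proof.
move=> n_gt0 v0 yt0; have [i _ vi0] : exists2 i, true & v i = 0.
  have /prodf_eq0[i _ /eqP vi0] : \prod_i v i == 0 by rewrite v0.
  by exists i.
pose V i := (v i)%:P.
have VE a : (fun i => (V i).[a]) = v by apply/funext => j; rewrite hornerC.
have := @linked_coords k m n r s L iota V y%:P (segment z z') t%:P 0 1 (idx_x i) 0.
rewrite !VE segment0 segment1 !hornerC; apply.
- by rewrite -rmorph_prod v0 rmorph0 expr0n gtn_eqF // mul0r -!rmorphXn -!rmorphD yt0.
- by rewrite coords_x /V vi0.
by rewrite base_ptE coords_x eq_sym oner_eq0.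
Qed.

(** * The fibres over the torus [x_prod != 0] *)

Definition fibre_pt (L : fieldType) (m n r s : nat) (v : 'I_m.+1 -> L) (y t : L) :
    'I_m.+4 -> L :=
  coords v y ((y ^+ r + t ^+ s + v ord0) / (\prod_i v i) ^+ n) t.

Lemma linked_fibre (k : fieldType) (m n r s : nat) (L : fieldType)
    (iota : {rmorphism k -> L}) (v : 'I_m.+1 -> L) (y t y' t' : L) :
  \prod_i v i != 0 ->
  [\/ y = y' /\ y != 0, t = t' /\ t != 0 | exists i, v i != 1] ->
  linked (X := punctured k m n r s) iota
    (fibre_pt n r s v y t) (fibre_pt n r s v y' t').
Proof.
move=> v_neq0 const; pose V i := (v i)%:P; pose Y := segment y y'.
pose T := segment t t'; pose d := ((\prod_i v i) ^+ n)^-1.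
pose Z := d%:P * (Y ^+ r + T ^+ s + V ord0).
have VE a : (fun i => (V i).[a]) = v by apply/funext => j; rewrite hornerC.
have ZE a : Z.[a] = (Y.[a] ^+ r + T.[a] ^+ s + v ord0) / (\prod_i v i) ^+ n.
  by rewrite hornerM mulrC hornerC 2!hornerD !horner_exp hornerC.
have line j c : coords V Y Z T j = c%:P -> c != iota (base_pt k m j) ->
    linked (X := punctured k m n r s) iota
      (fibre_pt n r s v y t) (fibre_pt n r s v y' t').
  move=> jc c_neq; have := @linked_coords k m n r s L iota V Y Z T 0 1 j c.
  rewrite !VE !ZE !segment0 !segment1; apply=> //.
  by rewrite -rmorph_prod -rmorphXn mulrA -rmorphM divff ?expf_neq0 // mul1r.
case: const => [[yy' y_neq0] | [tt' t_neq0] | [i vi_neq1]].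
- apply: (line (idx_y m) y); last by rewrite base_ptE coords_y.
  by rewrite coords_y /Y -yy' /segment subrr polyC0 mul0r addr0.
- apply: (line (idx_t m) t); last by rewrite base_ptE coords_t.
  by rewrite coords_t /T -tt' /segment subrr polyC0 mul0r addr0.
by apply: (line (idx_x i) (v i)); rewrite ?base_ptE coords_x.
Qed.

(** The fibre is a plane from which at most the origin is missing, so that two
    segments parallel to the axes lead to [(1, 1)]. *)
Lemma linked_fibre11 (k : fieldType) (m n r s : nat) (L : fieldType)
    (iota : {rmorphism k -> L}) (v : 'I_m.+1 -> L) (y z t : L) :
  \prod_i v i != 0 -> (\prod_i v i) ^+ n * z = y ^+ r + t ^+ s + v ord0 ->
  [\/ y != 0, t != 0 | exists i, v i != 1] ->
  linked (X := punctured k m n r s) iota (coords v y z t) (fibre_pt n r s v 1 1).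
Proof.
move=> v_neq0 zE not_base.
have -> : coords v y z t = fibre_pt n r s v y t.
  by rewrite /fibre_pt -zE mulrC mulKf // expf_neq0.
have [t0 | t_neq0] := eqVneq t 0.
  apply: (@linked_trans _ (punctured k m n r s) _ _ _ (fibre_pt n r s v y 1)).
    apply: linked_fibre => //; case: not_base => [y_neq0 | | v_neq1].
    - by apply: Or31.
    - by rewrite t0 eqxx.
    by apply: Or33.
  by apply: linked_fibre => //; apply: Or32; rewrite oner_eq0.
apply: (@linked_trans _ (punctured k m n r s) _ _ _ (fibre_pt n r s v 1 t)).
  by apply: linked_fibre => //; apply: Or32.
by apply: linked_fibre => //; apply: Or31; rewrite oner_eq0.
Qed.

(** The transversal curve, parametrized by [x_0] with the other [x_i] kept
    fixed, meets the fibre of the given point at the parameter [v ord0] and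
    arrives at [x_prod = 0] at the parameter [0]. *)
Lemma linked_torus_z0 (k : fieldType) (m n r s : nat) (L : fieldType)
    (iota : {rmorphism k -> L}) (v : 'I_m.+1 -> L) (y z t : L) :
  (0 < n)%N -> coprime r s ->
  \prod_i v i != 0 -> (\prod_i v i) ^+ n * z = y ^+ r + t ^+ s + v ord0 ->
  [\/ y != 0, t != 0 | exists i, v i != 1] ->
  exists v' y' t', y' ^+ r + t' ^+ s + v' ord0 = 0 /\
    linked (X := punctured k m n r s) iota (coords v y z t) (coords v' y' 0 t').
Proof.
case: n => // n _ rs v_neq0 zE not_base.
have [c [f [g [q [c_neq0 fg_c fgE]]]]] := @transversal_curve L r s n rs.
pose P := \prod_(i < m) v (lift ord0 i).
have P_neq0 : P != 0.
  by apply: contraNneq v_neq0 => P0; rewrite big_ord_recl -/P P0 mulr0.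
pose V i := if i == ord0 then 'X else (v i)%:P.
pose Z := (P ^+ n.+1)^-1%:P * q.
have VE a : (fun i => (V i).[a]) = fun i => if i == ord0 then a else v i.
  by apply/funext => i; rewrite /V; case: eqP => _; rewrite ?hornerX ?hornerC.
have prodV : \prod_i V i = 'X * P%:P.
  by rewrite big_ord_recl /V eqxx /P rmorph_prod.
have curveE : (\prod_i V i) ^+ n.+1 * Z = f ^+ r + g ^+ s + V ord0.
  rewrite prodV /V eqxx fgE exprMn -rmorphXn /Z -mulrA [X in _ * X]mulrA -rmorphM.
  by rewrite divff ?expf_neq0 // mul1r.
have curve a b : linked (X := punctured k m n.+1 r s) iota
    (coords (fun i => (V i).[a]) f.[a] Z.[a] g.[a])
    (coords (fun i => (V i).[b]) f.[b] Z.[b] g.[b]).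
  case: fg_c => c_eq.
    by apply: (linked_coords _ _ curveE (j := idx_y m) (c := c));
      rewrite ?base_ptE coords_y.
  by apply: (linked_coords _ _ curveE (j := idx_t m) (c := c));
    rewrite ?base_ptE coords_t.
pose a := v ord0; pose v' i := if i == ord0 then 0 else v i.
have va : (fun i => (V i).[a]) = v.
  by rewrite VE; apply/funext => i; case: eqP => // ->.
have fibre_a : linked (X := punctured k m n.+1 r s) iota
    (coords v f.[a] Z.[a] g.[a]) (fibre_pt n.+1 r s v 1 1).
  apply: linked_fibre11 => //.
    have VEa i : (V i).[a] = v i by rewrite -[in RHS]va.
    have := congr1 (fun p => p.[a]) curveE.
    rewrite hornerM !hornerD !horner_exp horner_prod VEa => <-.
    by congr (_ ^+ _ * _); apply: eq_bigr => i _; rewrite VEa.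
  by case: fg_c => ->; rewrite hornerC; [apply: Or31 | apply: Or32].
have yt0 : f.[0] ^+ r + g.[0] ^+ s + v' ord0 = 0.
  have := congr1 (fun p => p.[0]) fgE.
  by rewrite !hornerD !horner_exp hornerX hornerM hornerXn expr0n mul0r /v' eqxx.
exists v', f.[0], g.[0]; split=> //.
have := @linked_x0 k m n.+1 r s L iota v' f.[0] g.[0] Z.[0] 0 isT _ yt0.
rewrite big_ord_recl /v' eqxx mul0r => /(_ erefl) to_z0.
apply: (@linked_trans _ (punctured k m n.+1 r s)) (linked_fibre11 _ v_neq0 zE not_base) _.
apply: (@linked_trans _ (punctured k m n.+1 r s)) (linked_sym fibre_a) _.
by have := curve a 0; rewrite va VE => to_x0; apply: linked_trans to_x0 to_z0.
Qed.

Lemma point_neq_base (k : fieldType) (m n r s : nat) (L : fieldType)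
    (iota : {rmorphism k -> L}) (x : 'I_m.+4 -> L) :
  is_point (X := punctured k m n r s) iota x ->
  exists j, x j != iota (base_pt k m j).
Proof.
case/is_point_puncturedP => _ [c cP]; apply/existsP.
apply: contra_eqT cP; rewrite negb_exists => /forallP x_base.
rewrite big1 ?[0 == 1]eq_sym ?oner_eq0 // => j _.
by have := x_base j; rewrite negbK => /eqP ->; rewrite subrr mulr0.
Qed.

Lemma linked_to_z0 (k : fieldType) (m n r s : nat) (L : fieldType)
    (iota : {rmorphism k -> L}) (x : 'I_m.+4 -> L) :
  (0 < n)%N -> (0 < r)%N -> (0 < s)%N -> coprime r s ->
  is_point (X := punctured k m n r s) iota x ->
  exists v y t, y ^+ r + t ^+ s + v ord0 = 0 /\
    linked (X := punctured k m n r s) iota x (coords v y 0 t).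
Proof.
move=> n_gt0 r_gt0 s_gt0 rs x_pt; have [j xj] := point_neq_base x_pt.
have /is_point_puncturedP[xE _] := x_pt.
have xc : x = coords (x \o @idx_x m) (x (idx_y m)) (x (idx_z m)) (x (idx_t m)).
  by apply/funext => i; rewrite coords_eta.
move: xE xj; rewrite xc.
move: (_ \o _) (x (idx_y m)) (x (idx_z m)) (x (idx_t m)) => v y z t {xc x_pt}.
rewrite hyp_val_coords => /eqP; rewrite subr_eq0 => /eqP zE; rewrite base_ptE => xj.
have [v0 | v_neq0] := eqVneq (\prod_i v i) 0.
  have yt0 : y ^+ r + t ^+ s + v ord0 = 0.
    by rewrite -zE v0 expr0n gtn_eqF // mul0r.
  by exists v, y, t; split=> //; apply: linked_x0.
apply: linked_torus_z0 => //; have [v1 | ] := boolP [forall i, v i == 1]; last first.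
  by rewrite negb_forall => /existsP[i vi]; apply: Or33; exists i.
have vE : v = fun=> 1 by apply/funext => i; apply/eqP/(forallP v1).
have [y0 | ] := eqVneq y 0; last by move=> ?; apply: Or31.
have [t0 | ] := eqVneq t 0; last by move=> ?; apply: Or32.
move: zE xj; rewrite vE y0 t0 big1 // expr1n mul1r !expr0n !gtn_eqF // !add0r => ->.
by move/negP; case.
Qed.

Lemma punctured_chain_connected (k : fieldType) (m n r s : nat) :
  (2 <= n)%N -> (0 < r)%N -> (0 < s)%N -> coprime r s ->
  A1_chain_connected (punctured k m n r s).
Proof.
move=> n_gt1 r_gt0 s_gt0 rs; split=> [|L iota _]; first exact: punctured_smooth.
have n_gt0 := ltnW n_gt1; split=> [|x y x_pt y_pt].
  exists (coords (fun=> 0) 0 0 0 : 'I_m.+4 -> L).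
  apply: (@is_point_unit _ _ _ _ _ _ _ _ (idx_z m) (-1)).
    by rewrite hyp_val_coords !expr0n !gtn_eqF // mulr0 !addr0 subrr.
  by rewrite base_ptE !coords_z sub0r mulrNN mulr1.
have [v [a [b [ab0 xv]]]] := linked_to_z0 n_gt0 r_gt0 s_gt0 rs x_pt.
have [w [c [d [cd0 yw]]]] := linked_to_z0 n_gt0 r_gt0 s_gt0 rs y_pt.
have [chain _] := linked_trans (linked_trans xv (linked_z0 n iota ab0 cd0)) (linked_sym yw).
exact: chain.
Qed.

(** * Localization at one element *)

(** The localization [R[1/a]], realized inside the fraction field. *)
Definition away_pred (R : idomainType) (a : R) : {pred {fraction R}} :=
  fun c => `[< exists N p, c * tofrac a ^+ N = tofrac p >].

Lemma away_predP (R : idomainType) (a : R) (c : {fraction R}) :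
  reflect (exists N p, c * tofrac a ^+ N = tofrac p) (c \in away_pred a).
Proof. exact: asboolP. Qed.

Lemma away_subring (R : idomainType) (a : R) : subring_closed (away_pred a).
Proof.
split=> [|c d /away_predP[N [p cE]] /away_predP[M [q dE]]
         |c d /away_predP[N [p cE]] /away_predP[M [q dE]]]; apply/away_predP.
- by exists 0, 1; rewrite expr0 mulr1 tofrac1.
- exists (N + M), (p * a ^+ M - q * a ^+ N).
  by rewrite tofracB !tofracM -cE -dE !tofracXn exprD; ring.
by exists (N + M), (p * q); rewrite tofracM -cE -dE exprD; ring.
Qed.

HB.instance Definition _ (R : idomainType) (a : R) :=
  GRing.isSubringClosed.Build {fraction R} (away_pred a) (away_subring a).

Record away (R : idomainType) (a : R) :=
  Away { away_val : {fraction R}; _ : away_val \in away_pred a }.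

HB.instance Definition _ (R : idomainType) (a : R) := [isSub for @away_val R a].
HB.instance Definition _ (R : idomainType) (a : R) := [Choice of away a by <:].
HB.instance Definition _ (R : idomainType) (a : R) :=
  [SubChoice_isSubComNzRing of away a by <:].

Lemma away_tofrac (R : idomainType) (a p : R) : tofrac p \in away_pred a.
Proof. by apply/away_predP; exists 0, p; rewrite expr0 mulr1. Qed.

Definition away_of (R : idomainType) (a p : R) : away a := Away (away_tofrac a p).

Lemma away_of_zmod (R : idomainType) (a : R) : zmod_morphism (@away_of R a).
Proof. by move=> p q; apply: val_inj; rewrite rmorphB /= tofracB. Qed.

Lemma away_of_monoid (R : idomainType) (a : R) : monoid_morphism (@away_of R a).
Proof.
split=> [|p q]; apply: val_inj; first by rewrite rmorph1 /= tofrac1.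
by rewrite rmorphM /= tofracM.
Qed.

HB.instance Definition _ (R : idomainType) (a : R) :=
  GRing.isZmodMorphism.Build R (away a) (@away_of R a) (@away_of_zmod R a).
HB.instance Definition _ (R : idomainType) (a : R) :=
  GRing.isMonoidMorphism.Build R (away a) (@away_of R a) (@away_of_monoid R a).

Lemma away_unit (R : idomainType) (a : R) :
  a != 0 -> exists b : away a, b * away_of a a = 1.
Proof.
move=> a_neq0; have fa_neq0 : tofrac a != 0 by rewrite tofrac_eq0.
have a1 : (tofrac a)^-1 \in away_pred a.
  by apply/away_predP; exists 1, 1; rewrite expr1 mulVf // tofrac1.
by exists (Away a1); apply: val_inj; rewrite rmorphM rmorph1 /= mulVf.
Qed.

(** In the fraction field of [k[Y][T]], the intersection of the localizations
    at [Y] and at [T] is [k[Y][T]]: if ['X ^+ M * p = Y ^+ N * q], then [Y ^+ N]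
    divides each coefficient of [p], as these are the coefficients of the
    left-hand side, shifted. *)
Lemma away_inter (k : fieldType) (c : {fraction {poly {poly k}}}) :
  c \in away_pred ('X%:P : {poly {poly k}}) -> c \in away_pred ('X : {poly {poly k}}) ->
  exists p, c = tofrac p.
Proof.
move=> /away_predP[N [p cN]] /away_predP[M [q cM]]; exists (drop_poly M q).
set Y : {poly {poly k}} := 'X%:P in cN.
have YN_neq0 : tofrac Y ^+ N != 0.
  by rewrite expf_neq0 // tofrac_eq0 polyC_eq0 polyX_eq0.
have pqE : p * 'X^M = Y ^+ N * q.
  by apply/eqP; rewrite -tofrac_eq !tofracM !tofracXn -cN -cM; apply/eqP; ring.
have pE : p = Y ^+ N * drop_poly M q.
  apply/polyP => i; rewrite -rmorphXn coefCM coef_drop_poly -coefCM rmorphXn -pqE.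
  by rewrite coefMXn ltnNge leq_addl /= addnK.
by apply: (mulIf YN_neq0); rewrite cN pE tofracM tofracXn mulrC.
Qed.

(** * Failure of affineness *)

(** The plane [x_i = 1] with coordinates [Y] and [T] gives points of the
    punctured hypersurface over the localizations of [k[Y][T]] at [Y] and at
    [T].  If an algebra [B] represented the punctured hypersurface, these
    points would be homomorphisms from [B] that agree in the fraction field,
    and hence land in [k[Y][T]].  An equation
    [\sum_j c j * (u j - p j) = 1] in [B], which expresses that the universal
    point [u] avoids the base point [p], would then hold in [k[Y][T]] for the
    plane; but at the origin the plane passes through [p]. *)
Lemma punctured_not_affine (k : fieldType) (m n r s : nat) :
  (0 < r)%N -> (0 < s)%N -> strictly_quasi_affine (punctured k m n r s).
Proof.
move=> r_gt0 s_gt0; set U := punctured k m n r s.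
pose R := {poly {poly k}}; pose Y : R := 'X%:P; pose T : R := 'X.
pose x : 'I_m.+4 -> R := coords (fun=> 1) Y (Y ^+ r + T ^+ s + 1) T.
pose iotaR : {rmorphism k -> R} := (polyC \o polyC : {rmorphism k -> R}).
pose iota_away a : {rmorphism k -> away a} := (@away_of R a \o iotaR : {rmorphism k -> away a}).
pose iotaF : {rmorphism k -> {fraction R}} := (@tofrac R \o iotaR : {rmorphism k -> {fraction R}}).
have x_val : hyp_val n r s x = 0 by rewrite hyp_val_coords big1 // expr1n mul1r subrr.
have x_pt j : x j != 0 -> base_pt k m j = 0 ->
    is_point (X := U) (iota_away (x j)) (@away_of R (x j) \o x).
  move=> xj_neq0 pj; have [b bP] := away_unit xj_neq0.
  apply: (@is_point_unit _ _ _ _ _ _ _ _ j b).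
    by rewrite (@hyp_val_morph _ _ (@away_of R (x j)) _ _ _ _ x) // x_val rmorph0.
  by rewrite pj rmorph0 subr0.
have xY : is_point (X := U) (iota_away Y) (@away_of R Y \o x).
  have := x_pt (idx_y m); rewrite /x coords_y; apply; last by rewrite base_pt_coords coords_y.
  by rewrite polyC_eq0 polyX_eq0.
have xT : is_point (X := U) (iota_away T) (@away_of R T \o x).
  have := x_pt (idx_t m); rewrite /x coords_t; apply; last by rewrite base_pt_coords coords_t.
  by rewrite polyX_eq0.
(* The representability alternative; the empty scheme is excluded by [xY]. *)
case=> [[B [iotaB [u [u_pt univ]]]] | /(_ _ _ _ xY) //].
have [[phi [phi_k phi_u]] _] := univ _ _ _ xY.
have [[psi [psi_k psi_u]] _] := univ _ _ _ xT.
pose phiF : {rmorphism B -> {fraction R}} :=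
  ((val : {rmorphism away Y -> {fraction R}}) \o phi : {rmorphism B -> {fraction R}}).
pose psiF : {rmorphism B -> {fraction R}} :=
  ((val : {rmorphism away T -> {fraction R}}) \o psi : {rmorphism B -> {fraction R}}).
have phiF_k : is_kalg_hom iotaB iotaF phiF by move=> e; rewrite /= phi_k.
have psiF_k : is_kalg_hom iotaB iotaF psiF by move=> e; rewrite /= psi_k.
have phiF_u : phiF \o u =1 @tofrac R \o x by move=> j; have /= -> := phi_u j.
have psiF_u : psiF \o u =1 @tofrac R \o x by move=> j; have /= -> := psi_u j.
have xF : is_point (X := U) iotaF (@tofrac R \o x) by apply: is_point_morph u_pt; eassumption.
have phi_psi : phiF =1 psiF by apply: (univ _ _ _ xF).2.
have phiF_R h : exists p, phiF h = tofrac p.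
  apply: away_inter; first exact: valP.
  by rewrite phi_psi; apply: valP.
move/is_point_puncturedP: u_pt => [_ [c cP]].
have [d dP] := fin_all_exists (fun j => phiF_R (c j)).
have sum1 : \sum_j d j * (x j - iotaR (base_pt k m j)) = 1.
  apply/eqP; rewrite -tofrac_eq tofrac1 -(rmorph1 phiF) -cP !rmorph_sum; apply/eqP.
  apply: eq_bigr => j _; rewrite !rmorphM !rmorphB dP phiF_k.
  by congr (_ * (_ - _)); apply: esym (phiF_u j).
pose ev (p : R) := p.[0].[0].
have x0 j : ev (x j) = base_pt k m j.
  rewrite base_pt_coords -[LHS]/((ev \o x) j) coords_comp /coords /= /ev /Y /T.
  rewrite !hornerD !horner_exp !(hornerC, hornerX, horner_exp) !expr0n !gtn_eqF //.
  by rewrite !add0r.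
have /eqP := congr1 ev sum1; rewrite /ev horner_sum hornerC hornerC.
rewrite horner_sum big1 ?[0 == 1]eq_sym ?oner_eq0 // => j _.
by rewrite !(hornerM, hornerD, hornerN, hornerC) -/(ev (x j)) x0 subrr mulr0.
Qed.

Theorem lemma5p3p7 (k : fieldType) (m n r s : nat)
    (k_infinite : infinite_field k) (k_perfect : perfect_field k)
    (hn : (2 <= n)%N) (hr : (2 <= r)%N) (hs : (2 <= s)%N)
    (hrs : coprime r s) :
  let U := remove_point (X := hypersurface k m n r s) (base_pt k m) in
  strictly_quasi_affine U /\ A1_chain_connected U.
Proof.
have [r_gt0 s_gt0] := (ltnW hr, ltnW hs).
split; first exact: punctured_not_affine.
exact: punctured_chain_connected.
Qed.
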